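(* There exists a (finite) evasive poset $\mathcal{P}$ such that $\mathcal{P}\times\mathcal{I}$ is non-evasive, where $\mathcal{I}$ is the poset on two elements $0,1$ ordered by $0<1$.
   Context: A (finite) simplicial $d$-complex $C$ is called non-evasive if either $d=0$ and $C$ is a single point, or $d>0$ and there is a vertex $v$ of $C$ such that both the link $\mathrm{Lk}(v,C)$ and the deletion $C-v$ (the subcomplex of all faces not containing $v$) are non-evasive. The order complex of a poset is the simplicial complex whose faces are the chains of the poset. A poset is non-evasive if its order complex is non-evasive, and evasive otherwise. The product $\mathcal{A}\times\mathcal{B}$ of posets on sets $A$, $B$ is the poset on $A\times B$ with $(a,b)\preceq(a',b')$ if and only if $a\preceq a'$ and $b\preceq b'$. *)

(* Defs.v *)
From HB Require Import structures.
From mathcomp Require Import all_boot all_order all_algebra.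

Set Implicit Arguments.
Unset Strict Implicit.
Unset Printing Implicit Defensive.

Import Order.TTheory.

(* A complex on a subset of [T] is its family of faces.  The empty face is    *)
(* included, so the empty complex is [[set set0]] and has dimension -1; the   *)
(* vertex set consists of the [v] with [[set v] \in C], which need not be     *)
(* all of [T].                                                                *)
Definition simplicial_complex (T : finType) (C : {set {set T}}) : bool :=
  (set0 \in C) && [forall s in C, powerset s \subset C].

Section Complexes.
Context {T : finType}.
Implicit Types (C : {set {set T}}) (s t : {set T}) (v : T).

Definition dim C : int := ((\max_(s in C) #|s|)%:Z - 1)%R.

Definition link v C : {set {set T}} :=
  [set s : {set T} | (v \notin s) && (v |: s \in C)].

Definition deletion v C : {set {set T}} := [set s in C | v \notin s].

Definition is_point C : Prop := exists v, C = [set set0; [set v]].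

Inductive nonevasive C : Prop :=
| NonevasivePoint of dim C = 0%R & is_point C
| NonevasiveStep v of (0 < dim C)%R & [set v] \in C
    & nonevasive (link v C) & nonevasive (deletion v C).

Lemma simplicial_complexP C :
  reflect (set0 \in C /\ forall s t, s \in C -> t \subset s -> t \in C)
          (simplicial_complex C).
Proof.
apply: (iffP andP) => -[C0 Csub]; split=> //.
  move=> s t Cs ts; have /subsetP := forall_inP Csub s Cs.
  by apply; rewrite powersetE.
apply/forall_inP=> s Cs; apply/subsetP=> t; rewrite powersetE.
exact: Csub.
Qed.

Lemma link_complex v C :
  simplicial_complex C -> [set v] \in C -> simplicial_complex (link v C).
Proof.
move=> /simplicial_complexP[_ CS] Cv; apply/simplicial_complexP; split.
  by rewrite !inE setU0.
move=> s t; rewrite !inE => /andP[vs Cvs] ts; apply/andP; split.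
  by apply: contra vs; apply: (subsetP ts).
exact: CS Cvs (setUS _ ts).
Qed.

Lemma deletion_complex v C :
  simplicial_complex C -> simplicial_complex (deletion v C).
Proof.
move=> /simplicial_complexP[C0 CS]; apply/simplicial_complexP; split.
  by rewrite !inE C0.
move=> s t; rewrite !inE => /andP[Cs vs] ts; rewrite (CS s) //=.
by apply: contra vs; apply: (subsetP ts).
Qed.

End Complexes.

Definition order_complex (d : Order.disp_t) (P : finPOrderType d) :
    {set {set P}} :=
  [set s : {set P} | [forall x in s, forall y in s, (x >=< y)%O]].

Lemma order_complex_complex (d : Order.disp_t) (P : finPOrderType d) :
  simplicial_complex (order_complex P).
Proof.
apply/simplicial_complexP; split.
  by rewrite inE; apply/forall_inP=> x; rewrite inE.
move=> s t; rewrite !inE => /forall_inP Cs /subsetP ts.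
apply/forall_inP=> x /ts xs; apply/forall_inP=> y /ts ys.
exact: (forall_inP (Cs x xs)).
Qed.

Definition nonevasive_poset (d : Order.disp_t) (P : finPOrderType d) : Prop :=
  nonevasive (order_complex P).

Definition evasive_poset (d : Order.disp_t) (P : finPOrderType d) : Prop :=
  ~ nonevasive_poset P.

(* Main.v *)
(* A non-evasive complex has vanishing reduced Euler characteristic.  In the  *)
(* 13-point poset used here, of height 3, the link of every vertex is a graph *)
(* with nonzero reduced Euler characteristic, so no first vertex can be       *)
(* removed.  The poset is nevertheless collapsible: 5 is the only element     *)
(* between 0 and 9, so 0 < 9 is a free edge; collapsing it frees 5 < 9, since *)
(* 1 is the only other element below 5, and without these two edges the       *)
(* complex is dismantled by vertex removals.  In the product with I, vertex   *)
(* removals simulate these collapses: removing (9, 1) and (0, 0) leaves the   *)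
(* incomparable (0, 1) and (9, 0), and then (5, 0) covers only (1, 0).        *)
From HB Require Import structures.
Require Import Defs.
From mathcomp Require Import all_boot all_order all_algebra.

Set Implicit Arguments.
Unset Strict Implicit.
Unset Printing Implicit Defensive.

Import Order.TTheory GRing.Theory Num.Theory.

(** Both halves become finite computations because an order complex is a flag complex: links and
    deletions of flag complexes are flag complexes on smaller vertex sets, so the recursion runs on
    lists of vertices. Evasiveness of [point] follows from [nonevasive_euler], applied to the link
    of each candidate first vertex. For the product, two removals are given explicitly and a greedy
    search, sound by [dismantlable_nonevasive], supplies the rest. *)

Section EulerCharacteristic.
Context {T : finType}.
Implicit Types (C : {set {set T}}) (v : T).

Definition euler C : int := (\sum_(s in C) (-1) ^+ #|s|)%R.

(** Faces containing [v] correspond to faces of the link by removing [v], which flips the sign. *)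
Lemma euler_split v C : euler C = (euler (deletion v C) - euler (link v C))%R.
Proof.
rewrite /euler (bigID (fun s : {set T} => v \notin s)) /=; congr (_ + _)%R.
  by apply: eq_bigl => s; rewrite inE.
rewrite -sumrN (reindex_onto (fun s => v |: s) (fun s => s :\ v)) /=.
  apply: eq_big => s.
    rewrite [in RHS]inE setU11 /= andbT andbC; congr (_ && _).
    apply/eqP/idP => [<-|vs]; first by rewrite !inE eqxx.
    by rewrite setU1K.
  case/andP=> _ /eqP sE; have vs : v \notin s by rewrite -sE !inE eqxx.
  by rewrite cardsU1 vs exprS mulN1r.
by move=> s /andP[_]; rewrite negbK => vs; rewrite setD1K.
Qed.

Lemma nonevasive_euler C : nonevasive C -> euler C = 0%R.
Proof.
elim=> {C} [C _ [v ->]|C v _ _ _ IHl _ IHd]; last first.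
  by rewrite (euler_split v) IHl IHd subrr.
rewrite /euler big_setU1 /=; last first.
  by rewrite inE eq_sym; apply/set0Pn; exists v; rewrite set11.
by rewrite big_set1 cards0 cards1 expr0 expr1 subrr.
Qed.

(** Applied to a link, this yields an edge, hence positive dimension. *)
Lemma nonevasive_vertex C : nonevasive C -> exists v, [set v] \in C.
Proof.
by case=> [_ [v ->]|v _ Cv _ _]; exists v => //; rewrite !inE eqxx orbT.
Qed.

End EulerCharacteristic.

(** * Flag complexes of a graph, parametrized by their vertex sets *)

Section CliqueComplex.
Context {T : finType}.
Variable r : rel T.
Hypothesis (r_refl : reflexive r) (r_sym : symmetric r).
Implicit Types (A : {set T}) (l : seq T) (v : T).

Definition cliques A : {set {set T}} :=
  [set s : {set T} | (s \subset A) && [forall x in s, forall y in s, r x y]].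

Lemma cliquesP A (s : {set T}) :
  reflect (s \subset A /\ {in s &, forall x y, r x y}) (s \in cliques A).
Proof.
rewrite inE; apply: (iffP andP) => -[sA rs]; split=> //.
  by move=> x y xs ys; apply: (forall_inP (forall_inP rs x xs)).
by apply/forall_inP=> x xs; apply/forall_inP=> y ys; apply: rs.
Qed.

Lemma cliques1 A v : ([set v] \in cliques A) = (v \in A).
Proof.
apply/cliquesP/idP => [[]|vA]; first by rewrite sub1set.
by rewrite sub1set; split=> // x y /set1P-> /set1P->.
Qed.

Definition nbhd A v := [set w in A | r v w && (w != v)].

Lemma link_cliques A v : v \in A -> link v (cliques A) = cliques (nbhd A v).
Proof.
move=> vA; apply/setP=> s; rewrite inE.
apply/andP/cliquesP => [[vs /cliquesP[/subsetP sA rs]]|[/subsetP sN rs]].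
  split=> [|x y xs ys]; last by apply: rs; rewrite !inE ?xs ?ys orbT.
  apply/subsetP=> x xs; rewrite inE sA ?rs ?inE ?eqxx ?xs ?orbT //=.
  by apply: contraNneq vs => <-.
split; first by apply/negP=> /sN; rewrite !inE eqxx !andbF.
apply/cliquesP; split.
  by apply/subsetP=> x /setU1P[->|/sN]; rewrite // inE => /andP[].
have rv x : x \in s -> r v x by move=> /sN; rewrite inE => /and3P[].
move=> x y /setU1P[->|xs] /setU1P[->|ys] //; first exact: rv.
  by rewrite r_sym; apply: rv.
exact: rs.
Qed.

Lemma deletion_cliques A v : deletion v (cliques A) = cliques (A :\ v).
Proof.
by apply/setP=> s; rewrite !inE subsetD1 -!andbA; congr andb; rewrite andbC.
Qed.

Lemma dim_cliques_gt0 A v w :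
  v \in A -> w \in nbhd A v -> (0 < Defs.dim (cliques A))%R.
Proof.
rewrite inE => vA /and3P[wA rvw wv].
have Cvw : [set v; w] \in cliques A.
  apply/cliquesP; split; first by rewrite subUset !sub1set vA.
  by move=> x y /set2P[]-> /set2P[]-> //; rewrite r_sym.
rewrite /Defs.dim subr_gt0 ltz_nat.
apply: leq_trans (leq_bigmax_cond _ Cvw).
by rewrite cards2 eq_sym wv.
Qed.

(** The dimension condition of [NonevasiveStep] is automatic, since the non-evasive link has a
    vertex. *)
Lemma nonevasive_step A v : v \in A ->
  nonevasive (cliques (nbhd A v)) -> nonevasive (cliques (A :\ v)) ->
  nonevasive (cliques A).
Proof.
move=> vA neL neD; have [w] := nonevasive_vertex neL; rewrite cliques1 => wN.
apply: (NonevasiveStep (v := v) (dim_cliques_gt0 vA wN)); first by rewrite cliques1.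
  by rewrite link_cliques.
by rewrite deletion_cliques.
Qed.

Lemma cliques_set1 v : cliques [set v] = [set set0; [set v]].
Proof.
apply/setP=> s; rewrite inE subset1 orbC in_set2; apply: andb_idr.
by case/orP=> /eqP->; apply/forall_inP=> x /[!inE] // /eqP->;
  apply/forall_inP=> y /[!inE] /eqP->.
Qed.

Lemma nonevasive_cliques1 v : nonevasive (cliques [set v]).
Proof.
rewrite cliques_set1; apply: NonevasivePoint; last by exists v.
rewrite /Defs.dim big_setU1 /=; last first.
  by rewrite inE eq_sym; apply/set0Pn; exists v; rewrite set11.
by rewrite big_set1 cards0 cards1.
Qed.

(** Removing any [w] other than the apex [v] leaves both the link and the deletion as smaller cones
    with apex [v]; the induction ends at a point. *)
Lemma nonevasive_cone A v :
  v \in A -> {in A, forall w, r v w} -> nonevasive (cliques A).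
Proof.
have [n] := ubnP #|A|; elim: n => // n IHn in A * => /ltnSE leAn vA rvA.
have [/eqP|[w]] := set_0Vmem (A :\ v).
  by rewrite setD_eq0 subset1 => /orP[/eqP->|/eqP A0];
    [apply: nonevasive_cliques1 | rewrite A0 inE in vA].
case/setD1P=> wv wA.
have ltA (B : {set T}) : B \subset A :\ w -> #|B| < n.
  move=> /subset_leq_card leB; apply: leq_trans leAn.
  by rewrite (cardsD1 w A) wA ltnS.
apply: (nonevasive_step wA); apply: IHn.
- by apply: ltA; apply/subsetP=> x; rewrite !inE => /and3P[-> _ ->].
- by rewrite inE vA r_sym rvA //= eq_sym.
- by move=> x; rewrite inE => /andP[/rvA].
- exact: ltA.
- by rewrite !inE vA eq_sym wv.
- by move=> x /setD1P[_ /rvA].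
Qed.

Definition nbseq l v := [seq w <- l | r v w && (w != v)].

Definition delseq l v := [seq w <- l | w != v].

Lemma nbseqE l v : nbhd [set x in l] v = [set x in nbseq l v].
Proof. by apply/setP=> x; rewrite !inE mem_filter andbC. Qed.

Lemma delseqE l v : [set x in l] :\ v = [set x in delseq l v].
Proof. by apply/setP=> x; rewrite !inE mem_filter. Qed.

(* [n] is fuel; the first vertex with a dismantlable link is removed, without *)
(* backtracking.  The lazy [if] and [find] keep [vm_compute] from testing the *)
(* remaining vertices.                                                        *)
Fixpoint dismantlable (n : nat) l : bool :=
  if n isn't n'.+1 then false else
  if has (fun v => all (r v) l) l then true else
  if drop (find (fun v => dismantlable n' (nbseq l v)) l) l is v :: _
  then dismantlable n' (delseq l v) else false.

Lemma dismantlable_nonevasive n l :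
  dismantlable n l -> nonevasive (cliques [set x in l]).
Proof.
elim: n l => //= n IHn l; case: ifPn => [/hasP[v vl /allP rv] _|_].
  by apply: (@nonevasive_cone _ v) => [|w]; rewrite inE //; apply: rv.
set p := fun v => _; case E: (drop _ l) => [//|v l1] neD.
(* A nonempty tail means that [find] stopped inside [l], so its head [v] satisfies [p]. *)
have lt_find : find p l < size l.
  by rewrite ltnNge; apply/negP=> /drop_oversize; rewrite E.
move: (E); rewrite (drop_nth v) // => -[vE _].
have neL : p v by rewrite -vE; apply: nth_find; rewrite has_find.
have vl : v \in l by rewrite -vE mem_nth.
apply: (@nonevasive_step _ v); first by rewrite inE.
  by rewrite nbseqE; apply: IHn.
by rewrite delseqE; apply: IHn.
Qed.

(** The recursion of [euler_split] on lists. The value 1 on the empty list counts the empty face;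
    the value 0 is reached only when the fuel [n] runs out. *)
Fixpoint euler_seq (n : nat) l : int :=
  if n isn't n'.+1 then 0%R else
  if l is v :: l' then
    (euler_seq n' l' - euler_seq n' [seq w <- l' | r v w])%R
  else 1%R.

Lemma euler_cliques n l :
  size l < n -> uniq l -> euler (cliques [set x in l]) = euler_seq n l.
Proof.
elim: n l => //= n IHn [_ _|v l /= ltln /andP[vl ul]].
  rewrite /euler (_ : cliques _ = [set set0]) ?big_set1 ?cards0 //.
  apply/setP=> s; apply/cliquesP/set1P=> [[]|->].
    by rewrite set_nil subset0 => /eqP.
  by split=> [|x y]; rewrite ?sub0set ?inE.
rewrite (euler_split v) deletion_cliques link_cliques ?inE ?eqxx //.
rewrite delseqE nbseqE /delseq /nbseq /= eqxx /= andbF.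
have nev w : w \in l -> w != v by move=> wl; apply: contraNneq vl => <-.
rewrite (all_filterP _); last by apply/allP=> w /nev.
rewrite (eq_in_filter (a2 := r v)) => [|w /nev->]; last by rewrite andbT.
rewrite !IHn ?filter_uniq //.
by rewrite size_filter; apply: leq_ltn_trans (count_size _ _) _.
Qed.

End CliqueComplex.

Section OrderComplex.
Context {d : Order.disp_t} {P : finPOrderType d}.
Let cmp : rel P := fun x y => (x >=< y)%O.

Lemma order_complexE : order_complex P = cliques cmp [set: P].
Proof. by apply/setP=> s; rewrite !inE subsetT. Qed.

End OrderComplex.

(* [ord_enum] does not compute, because [insub] relies on the opaque [idP].   *)
Definition ordinals n : seq 'I_n := pmap (insub_eq _) (iota 0 n).

Lemma ordinalsE n : ordinals n = ord_enum n.
Proof. exact: eq_pmap (insub_eqE _) _. Qed.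

Lemma mem_ordinals n (i : 'I_n) : i \in ordinals n.
Proof. by rewrite ordinalsE mem_ord_enum. Qed.

(** * The evasive poset on 13 points *)

Definition point : Type := 'I_13.
HB.instance Definition _ := Finite.on point.

(** Strict up-sets: 0 to 3 are minimal, 4 to 8 form the middle level, and the default [[::]] makes 9
    to 12 maximal. *)
Definition upper (i : nat) : seq nat :=
  nth [::] [:: [:: 5; 6; 8; 9; 10; 11; 12]; [:: 4; 5; 6; 9; 10; 11; 12];
               [:: 4; 7; 8; 9; 10; 11; 12]; [:: 4; 6; 7; 9; 10; 11; 12];
               [:: 9; 11]; [:: 9; 10; 11]; [:: 10; 12]; [:: 9; 10; 12];
               [:: 11; 12]] i.

Definition point_le : rel point := fun i j => (i == j) || (val j \in upper (val i)).

Definition points : seq point := ordinals 13.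

Lemma mem_points (x : point) : x \in points.
Proof. exact: mem_ordinals. Qed.

Lemma point_le_refl : reflexive point_le.
Proof. by move=> i; rewrite /point_le eqxx. Qed.

Lemma point_le_anti : antisymmetric point_le.
Proof.
have: all (fun x => all (fun y => point_le x y && point_le y x ==> (x == y))
          points) points by vm_compute.
move=> /allP H x y lexy.
by have /allP/(_ y (mem_points y))/implyP/(_ lexy)/eqP := H x (mem_points x).
Qed.

Lemma point_le_trans : transitive point_le.
Proof.
have: all (fun y => all (fun x => all (fun z =>
   point_le x y ==> (point_le y z ==> point_le x z))
   points) points) points by vm_compute.
move=> /allP H y x z lexy leyz.
have /allP/(_ x (mem_points x))/allP/(_ z (mem_points z)) := H y (mem_points y).
by rewrite lexy leyz.
Qed.

Fact point_display : Order.disp_t. Proof. exact: Order.Disp tt tt. Qed.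

HB.instance Definition _ := Order.Le_isPOrder.Build point_display point
  point_le_refl point_le_anti point_le_trans.

Lemma point_evasive : evasive_poset point.
Proof.
rewrite /evasive_poset /nonevasive_poset order_complexE.
set r : rel point := fun x y => _.
have r_refl : reflexive r by move=> x; apply: comparablexx.
have r_sym : symmetric r by move=> x y; apply: comparable_sym.
(* Two distinct vertices rule out a point; otherwise the link of the removed vertex gives the
   contradiction. *)
case=> [_ [v Cv]|v _ _ + _].
  have: [set (ord0 : point)] \in cliques r [set: point] by rewrite cliques1.
  have: [set (ord_max : point)] \in cliques r [set: point] by rewrite cliques1.
  rewrite Cv !inE => /orP[/eqP/setP/(_ ord_max)|/eqP/set1_inj <-].
    by rewrite !inE eqxx.
  case/orP=> /eqP.
    by move/setP/(_ ord0); rewrite !inE eqxx.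
  by move/set1_inj.
rewrite link_cliques // (_ : [set: point] = [set x in points]); last first.
  by apply/setP=> x; rewrite in_setT in_set; apply/esym/mem_points.
rewrite nbseqE => /nonevasive_euler.
rewrite (euler_cliques r_refl r_sym (n := 14)); first last.
- by rewrite filter_uniq.
- by rewrite ltnS size_filter (leq_trans (count_size _ _)).
have: all (fun v => euler_seq r 14 (nbseq r points v) != 0%R)
        points by vm_compute.
by move=> /allP/(_ v (mem_points v))/eqP.
Qed.

(** * Non-evasiveness of the product with the two-element chain *)

Definition pairs : seq (point *p 'I_2) :=
  [seq (x, i) | x <- points, i <- ordinals 2].

Lemma mem_pairs (u : point *p 'I_2) : u \in pairs.
Proof.
by case: u => x i; apply: allpairs_f; [apply: mem_points | apply: mem_ordinals].
Qed.

Lemma product_nonevasive : nonevasive_poset (point *p 'I_2)%type.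
Proof.
rewrite /nonevasive_poset order_complexE.
set r : rel (point *p 'I_2) := fun x y => _.
have r_refl : reflexive r by move=> x; apply: comparablexx.
have r_sym : symmetric r by move=> x y; apply: comparable_sym.
rewrite (_ : [set: _] = [set x in pairs]); last first.
  by apply/setP=> u; rewrite in_setT in_set; apply/esym/mem_pairs.
(* Removing (9, 1) and then (0, 0) imitates the collapse of the edge 0 < 9. Fuel 26 exceeds the
   length of every list searched, and each recursive call shortens the list. *)
pose v : point *p 'I_2 := (Ordinal (isT : 9 < 13), ord_max).
pose w : point *p 'I_2 := (ord0, ord0).
apply: (nonevasive_step r_refl r_sym (v := v)).
- by rewrite inE.
- rewrite nbseqE; apply: (dismantlable_nonevasive r_refl r_sym (n := 26)).
  by vm_compute.
rewrite delseqE; apply: (nonevasive_step r_refl r_sym (v := w)).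
- by rewrite inE.
- rewrite nbseqE; apply: (dismantlable_nonevasive r_refl r_sym (n := 26)).
  by vm_compute.
rewrite delseqE; apply: (dismantlable_nonevasive r_refl r_sym (n := 26)).
by vm_compute.
Qed.

Theorem proposition2p1p9 :
  exists (d : Order.disp_t) (P : finPOrderType d),
    evasive_poset P /\ nonevasive_poset (P *p 'I_2)%type.
Proof.
by exists point_display, point; split;
  [apply: point_evasive | apply: product_nonevasive].
Qed.
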